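(* Let $\mathcal I$ be an ideal on $\mathbb N_0$ and let $\mathbf u=(u_n)_{n\in\mathbb N_0}$ be a sequence in an abelian group $G$. (a) If $\mathbf u$ is a $T^{\mathcal I}$-sequence, then there exists a metrizable group topology $\tau$ on $G$ such that $\mathbf u$ $\mathcal I$-converges to $0$ in $(G,\tau)$. (b) If $\mathbf u$ is a $TB^{\mathcal I}$-sequence in $G$ and $G=\langle\{u_n:n\in\mathbb N_0\}\rangle$, then there exists a precompact metrizable group topology $\tau$ on $G$ such that $\mathbf u$ $\mathcal I$-converges to $0$ in $(G,\tau)$.
   Context: $\mathbb N_0=\{0,1,2,\dots\}$. An ideal $\mathcal I$ on $\mathbb N_0$ is a nonempty family of subsets of $\mathbb N_0$ closed under taking subsets and finite unions. A sequence $(x_n)$ in a topological space $\mathcal I$-converges to $x$ if $\{n\in\mathbb N_0: x_n\notin U\}\in\mathcal I$ for every neighborhood $U$ of $x$. ''Precompact'' means Hausdorff and totally bounded. A sequence $\mathbf u$ in an abelian group $G$ is a $T^{\mathcal I}$-sequence (resp., $TB^{\mathcal I}$-sequence) if there is a Hausdorff (resp., precompact) group topology on $G$ in which $\mathbf u$ $\mathcal I$-converges to $0$. *)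

(* Defs.v *)
From HB Require Import structures.
From mathcomp Require Import all_boot all_order all_algebra.
From mathcomp Require Import all_classical all_reals all_analysis.
Set Implicit Arguments.
Unset Strict Implicit.
Unset Printing Implicit Defensive.
Import Order.TTheory GRing.Theory Num.Theory.

Local Open Scope classical_set_scope.
Local Open Scope ring_scope.

(* [T] may already carry some structure, so a topology on [T] is given by its
   family of open sets, and [topologized tau] is a copy of [T] on which the
   library sees [tau] as the topology. *)
Record topology_on (T : choiceType) := TopologyOn {
  opens : set_system T ;
  opensT : opens [set: T] ;
  opensI : setI_closed opens ;
  opens_bigcup : forall C : set_system T,
    C `<=` opens -> opens (\bigcup_(A in C) A)
}.

Definition topologized (T : choiceType) (tau : topology_on T) : Type := T.

Section Topologized.
Context (T : choiceType) (tau : topology_on T).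

Lemma opens_bigU (I : Type) (f : I -> set T) :
  (forall i, opens tau (f i)) -> opens tau (\bigcup_i f i).
Proof.
move=> fo; have -> : \bigcup_i f i = \bigcup_(A in range f) A.
  by rewrite bigcup_image.
by apply: opens_bigcup => _ [i _ <-].
Qed.

HB.instance Definition _ := Choice.copy (topologized tau) T.
HB.instance Definition _ := isOpenTopological.Build (topologized tau)
  (@opensT T tau) (@opensI T tau) opens_bigU.

End Topologized.

HB.instance Definition _ (G : zmodType) (tau : topology_on G) :=
  GRing.Zmodule.copy (topologized tau) G.

Record group_topology (G : zmodType) := GroupTopology {
  group_topology_on : topology_on G ;
  group_add_continuous : continuous
    (fun x : topologized group_topology_on * topologized group_topology_on =>
      x.1 + x.2) ;
  group_opp_continuous : continuous
    (-%R : topologized group_topology_on -> topologized group_topology_on)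
}.

Definition with_topology (G : zmodType) (tau : group_topology G) : Type :=
  topologized (group_topology_on tau).

HB.instance Definition _ (G : zmodType) (tau : group_topology G) :=
  Topological.copy (with_topology tau) (topologized (group_topology_on tau)).
HB.instance Definition _ (G : zmodType) (tau : group_topology G) :=
  GRing.Zmodule.copy (with_topology tau) (topologized (group_topology_on tau)).
HB.instance Definition _ (G : zmodType) (tau : group_topology G) :=
  PreTopologicalNmodule_isTopologicalNmodule.Build (with_topology tau)
    (@group_add_continuous G tau).
HB.instance Definition _ (G : zmodType) (tau : group_topology G) :=
  TopologicalNmodule_isTopologicalZmodule.Build (with_topology tau)
    (@group_opp_continuous G tau).

(* Neither properness nor containing the finite sets is required. *)
Definition is_ideal (I : set_system nat) : Prop :=
  [/\ I !=set0,
      forall A B, A `<=` B -> I B -> I A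
    & setU_closed I].

Definition ideal_cvg (I : set_system nat) (T : topologicalType)
    (x_ : nat -> T) (x : T) : Prop :=
  forall U, nbhs x U -> I [set n | ~ U (x_ n)].

(* Total boundedness for the uniformity of the topological group; the
   library's [precompact] means relatively compact instead. *)
Definition totally_bounded_group (G : topologicalZmodType) : Prop :=
  forall U : set G, nbhs 0 U ->
    exists2 F : set G, finite_set F &
      [set x + y | x in F & y in U] = [set: G].

Definition precompact_group (G : topologicalZmodType) : Prop :=
  hausdorff_space G /\ totally_bounded_group G.

Definition is_metric (R : realType) (T : Type) (d : T -> T -> R) : Prop :=
  [/\ forall x y, 0 <= d x y,
      forall x y, d x y = 0 <-> x = y,
      forall x y, d x y = d y x
    & forall x y z, d x z <= d x y + d y z].

Definition metrizable (R : realType) (T : topologicalType) : Prop :=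
  exists2 d : T -> T -> R, is_metric d &
    forall x : T, nbhs x =
      filter_from [set e : R | 0 < e] (fun e => [set y | d x y < e]).

Definition generated_subgroup (G : zmodType) (A : set G) : set G :=
  smallest [set H : set G | zmod_closed (fun x => x \in H)] A.

Definition T_sequence (I : set_system nat) (G : zmodType) (u : nat -> G) :
    Prop :=
  exists tau : group_topology G,
    hausdorff_space (with_topology tau) /\
    ideal_cvg I (u : nat -> with_topology tau) 0.

Definition TB_sequence (I : set_system nat) (G : zmodType) (u : nat -> G) :
    Prop :=
  exists tau : group_topology G,
    precompact_group (with_topology tau) /\
    ideal_cvg I (u : nat -> with_topology tau) 0.

(* Main.v *)
(* Pick neighborhoods [W n] of 0 with [W n.+1 + W n.+1 + W n.+1] inside [W n]
   and whose intersection meets the countable subgroup [H] generated by [u] only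
   in 0. The traces of the [W n] on [H] are a countable base at 0 of a Hausdorff
   group topology, metrizable by the Birkhoff-Kakutani chain construction, and
   [u] converges to 0 for it since every [u n] is in [H]. If [H = G], this
   topology is coarser than the original one, hence inherits total boundedness. *)
Require Import Defs.
From mathcomp Require Import all_boot all_order all_algebra.
From mathcomp Require Import all_classical all_reals all_analysis.
From mathcomp Require Import lra.
Set Implicit Arguments.
Unset Strict Implicit.
Unset Printing Implicit Defensive.
Import Order.TTheory GRing.Theory Num.Theory.

Local Open Scope classical_set_scope.
Local Open Scope ring_scope.

(** * Group topologies induced by a norm *)

Record group_norm (R : realType) (G : zmodType) (p : G -> R) : Prop := {
  group_norm0 : p 0 = 0 ;
  group_norm_eq0 : forall x, p x = 0 -> x = 0 ;
  group_norm_ge0 : forall x, 0 <= p x ;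
  group_normN : forall x, p (- x) = p x ;
  group_normD : forall x y, p (x + y) <= p x + p y }.

Section NormTopology.
Context (R : realType) (G : zmodType) (p : G -> R) (np : group_norm p).

Definition norm_ball (x : G) (e : R) : set G := [set y | p (x - y) < e].

Lemma norm_ball_triangle x y z e d :
  norm_ball x d y -> norm_ball y e z -> norm_ball x (d + e) z.
Proof.
rewrite /norm_ball /= => xy yz.
have -> : x - z = (x - y) + (y - z) by rewrite addrA subrK.
by apply: le_lt_trans (ltrD xy yz); apply: (group_normD np).
Qed.

Definition norm_open (A : set G) : Prop :=
  forall x, A x -> exists2 e, 0 < e & norm_ball x e `<=` A.

Lemma norm_openT : norm_open setT.
Proof. by move=> x _; exists 1. Qed.

Lemma norm_openI : setI_closed norm_open.
Proof.
move=> A B oA oB x [Ax Bx].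
have [e e0 eA] := oA _ Ax; have [d d0 dB] := oB _ Bx.
exists (Num.min e d); first by rewrite lt_min e0.
by move=> y; rewrite /norm_ball /= lt_min => /andP[ye yd]; split;
  [exact: eA|exact: dB].
Qed.

Lemma norm_open_bigcup (C : set_system G) :
  C `<=` norm_open -> norm_open (\bigcup_(A in C) A).
Proof.
move=> Co x [A CA Ax]; have [e e0 eA] := Co _ CA _ Ax.
by exists e => // y /eA Ay; exists A.
Qed.

Definition norm_topology_on : topology_on G :=
  TopologyOn norm_openT norm_openI norm_open_bigcup.

Lemma nbhs_norm_topologyP (x : topologized norm_topology_on)
    (A : set (topologized norm_topology_on)) :
  nbhs x A <-> exists2 e, 0 < e & norm_ball x e `<=` A.
Proof.
rewrite nbhsE; split.
  move=> [B [oB Bx] BA]; have [e e0 eB] := (oB : norm_open B) _ Bx.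
  by exists e => // y /eB/BA.
move=> [e e0 eA].
(* The witness is the interior of [A]: every point within [d / 2] of [y] still has a ball of radius
   [d / 2] inside [A]. *)
exists [set y | exists2 d, 0 < d & norm_ball y d `<=` A]; last first.
  by move=> y [d d0]; apply; rewrite /norm_ball /= subrr (group_norm0 np).
split; last by exists e.
suff : norm_open [set y | exists2 d, 0 < d & norm_ball y d `<=` A] by [].
move=> y [d d0 dA].
have d20 : 0 < d / 2 by rewrite divr_gt0.
exists (d / 2) => // z yz; exists (d / 2) => // t zt.
by apply: dA; rewrite (splitr d); apply: norm_ball_triangle zt.
Qed.

Lemma norm_add_continuous : continuous
  (fun x : topologized norm_topology_on * topologized norm_topology_on =>
    x.1 + x.2).
Proof.
move=> [x y] A /= /nbhs_norm_topologyP[e e0 eA].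
have e20 : 0 < e / 2 by rewrite divr_gt0.
exists (norm_ball x (e / 2), norm_ball y (e / 2)) => /=.
  by split; apply/nbhs_norm_topologyP; exists (e / 2).
move=> [z t] /= [xz yt]; apply: eA; rewrite /norm_ball /= in xz yt *.
rewrite opprD addrACA (splitr e); apply: le_lt_trans (ltrD xz yt).
exact: (group_normD np).
Qed.

Lemma norm_opp_continuous : continuous
  (-%R : topologized norm_topology_on -> topologized norm_topology_on).
Proof.
move=> x A /= /nbhs_norm_topologyP[e e0 eA].
apply/nbhs_norm_topologyP; exists e => // y xy; apply: eA.
by rewrite /norm_ball /= -opprD (group_normN np).
Qed.

Definition norm_group_topology : group_topology G :=
  GroupTopology norm_add_continuous norm_opp_continuous.

Lemma norm_topology_metrizable : metrizable R (with_topology norm_group_topology).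
Proof.
exists (fun x y => p (x - y)).
  split=> [x y|x y|x y|x y z].
  - exact: (group_norm_ge0 np).
  - split=> [/(group_norm_eq0 np)/eqP|->]; last by rewrite subrr (group_norm0 np).
    by rewrite subr_eq0 => /eqP.
  - by rewrite -opprB (group_normN np).
  - have -> : x - z = (x - y) + (y - z) by rewrite addrA subrK.
    exact: (group_normD np).
move=> x; apply/seteqP; split=> A.
  by move=> /nbhs_norm_topologyP[e e0 eA]; exists e.
by move=> [e e0 eA]; apply/nbhs_norm_topologyP; exists e.
Qed.

End NormTopology.

Lemma metrizable_hausdorff (R : realType) (T : topologicalType) :
  metrizable R T -> hausdorff_space T.
Proof.
move=> [d [d_ge0 d_eq0 dC d_triangle] nbhsT] x y xy; apply/d_eq0.
apply/eqP; rewrite eq_le d_ge0 andbT; apply/ler_addgt0Pr => e e0.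
have e20 : 0 < e / 2 by rewrite divr_gt0.
have nbhs_ball z : nbhs z [set t | d z t < e / 2] by rewrite nbhsT; exists (e / 2).
have [z [/= xz yz]] := xy _ _ (nbhs_ball x) (nbhs_ball y).
rewrite add0r; apply: le_trans (d_triangle x z y) _.
by rewrite (splitr e) lerD ?ltW// dC.
Qed.

(** * The Birkhoff-Kakutani chain construction *)

Section BirkhoffKakutani.
Context (R : realType) (G : zmodType) (V : nat -> set G).
Hypotheses (V0T : V 0%N = setT) (V0 : forall n, V n 0)
  (VN : forall n x, V n x -> V n (- x))
  (VD3 : forall n x y z, V n.+1 x -> V n.+1 y -> V n.+1 z -> V n (x + y + z))
  (Vsep : forall x, (forall n, V n x) -> x = 0).

(** A link [(n, x)] certifies that [x] lies in [V n], at cost [2^-n]. The norm of an element is the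
    infimum of the costs of writing it as a sum of links. *)
Definition chain (s : seq (nat * G)) : bool := all (fun a => a.2 \in V a.1) s.
Definition chain_sum (s : seq (nat * G)) : G := \sum_(a <- s) a.2.
Definition chain_weight (s : seq (nat * G)) : R := \sum_(a <- s) 2^-1 ^+ a.1.

Lemma chain_weight_ge0 s : 0 <= chain_weight s.
Proof. by apply: sumr_ge0 => a _; rewrite exprn_ge0// invr_ge0. Qed.

(** Take for [s1] the longest prefix of weight at most [c]. The next link [a] carries the weight
    past [c], which bounds what is left for [s2]. *)
Lemma chain_split s (c : R) : 0 <= c -> c < chain_weight s ->
  exists s1 a s2, [/\ s = s1 ++ a :: s2, chain_weight s1 <= c &
    chain_weight s2 < chain_weight s - c].
Proof.
elim: s c => [|a s IH] c c0; first by rewrite /chain_weight big_nil ltNge c0.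
rewrite /chain_weight big_cons -/(chain_weight s) => cs.
have [ca|ac] := ltP c (2^-1 ^+ a.1).
  exists [::], a, s; split=> //; first by rewrite /chain_weight big_nil.
  rewrite -/(chain_weight s); lra.
have [||s1 [b [s2 [-> s1c s2c]]]] := IH (c - 2^-1 ^+ a.1).
- by rewrite subr_ge0.
- by rewrite ltrBlDl.
exists (a :: s1), b, s2; split=> //.
  by rewrite /chain_weight big_cons -/(chain_weight s1) -lerBrDl.
move: s2c; rewrite /chain_weight; lra.
Qed.

Lemma V_decreasing m n : (m <= n)%N -> V n `<=` V m.
Proof.
move=> /subnK <-; elim: (n - m)%N => // k IH x; rewrite addSn => Vx.
by apply: IH; rewrite -[x]addr0 -[x]addr0; apply: VD3.
Qed.

(* A chain of weight less than [2^-n] splits around a link into two shorter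
   chains of at most half its weight. *)
Lemma chain_sum_small s n : chain s -> chain_weight s < 2^-1 ^+ n ->
  V n (chain_sum s).
Proof.
have [k] := ubnP (size s); elim: k s n => // k IH s n sk sV sn.
(* Splitting at half the weight requires a positive weight. Links have positive weight, so a chain
   of weight 0 is empty. *)
have [s0|s0] := eqVneq (chain_weight s) 0.
  case: s s0 {sk sV sn} => [_|a s]; first by rewrite /chain_sum big_nil.
  rewrite /chain_weight big_cons -/(chain_weight s) => /eqP.
  have : 0 < 2^-1 ^+ a.1 :> R by rewrite exprn_gt0// invr_gt0.
  have := chain_weight_ge0 s; lra.
have s_gt0 : 0 < chain_weight s by rewrite lt0r s0 chain_weight_ge0.
have [||s1 [a [s2 [sE s1c s2c]]]] := @chain_split s (chain_weight s / 2); [lra|lra|].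
have wE : chain_weight s = chain_weight s1 + (2^-1 ^+ a.1 + chain_weight s2).
  by rewrite sE /chain_weight big_cat big_cons.
move: sV sk; rewrite sE /chain all_cat /= => /and3P[s1V aV s2V].
rewrite size_cat /= addnS ltnS => sk.
rewrite /chain_sum big_cat big_cons /= addrA; apply: VD3.
- apply: IH => //; last by rewrite exprS; lra.
  exact: leq_ltn_trans (leq_addr _ _) sk.
- rewrite inE in aV; apply: V_decreasing aV.
  (* A link of index at most [n] would alone weigh at least [2^-n]. *)
  rewrite ltnNge; apply/negP => an.
  have : 2^-1 ^+ n <= 2^-1 ^+ a.1 :> R.
    by rewrite ler_wiXn2l// ?invr_ge0// invf_le1// ler1n.
  have := chain_weight_ge0 s1; have := chain_weight_ge0 s2; lra.
- apply: IH => //; last by rewrite exprS; lra.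
  exact: leq_ltn_trans (leq_addl _ _) sk.
Qed.

Definition chain_weights (x : G) : set R :=
  [set chain_weight s | s in [set s | chain s /\ chain_sum s = x]].

Definition chain_norm (x : G) : R := inf (chain_weights x).

Lemma chain_weights_single n x : V n x -> chain_weights x (2^-1 ^+ n).
Proof.
move=> Vx; exists [:: (n, x)]; last by rewrite /chain_weight big_seq1.
by split; rewrite ?/chain_sum ?big_seq1//= andbT inE.
Qed.

Lemma chain_weights_has_inf x : has_inf (chain_weights x).
Proof.
split; last by exists 0 => _ [s _ <-]; apply: chain_weight_ge0.
(* Since [V 0] is everything, each element is a one-link chain of weight 1. *)
by exists (2^-1 ^+ 0); apply: chain_weights_single; rewrite V0T.
Qed.

Lemma chain_norm_le x r : chain_weights x r -> chain_norm x <= r.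
Proof. by apply: ge_inf; case: (chain_weights_has_inf x). Qed.

Lemma chain_norm_le_geo n x : V n x -> chain_norm x <= 2^-1 ^+ n.
Proof. by move=> /chain_weights_single/chain_norm_le. Qed.

(** An infimum below [2^-n] is undercut by an actual chain. With [chain_norm_le_geo], this shows
    that the balls around 0 and the sets [V n] are equivalent bases. *)
Lemma chain_norm_lt_geo n x : chain_norm x < 2^-1 ^+ n -> V n x.
Proof.
move=> /inf_lt [|_ [s [sV <-] <-]]; last exact: chain_sum_small.
exact: (chain_weights_has_inf x).1.
Qed.

(** Negating all links preserves the weight, and concatenating chains adds weights. An element of
    norm 0 lies in every [V n], hence is 0 by [Vsep]. *)
Lemma chain_norm_group_norm : group_norm chain_norm.
Proof.
have ge0 x : 0 <= chain_norm x.
  apply: lb_le_inf; first exact: (chain_weights_has_inf x).1.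
  by move=> _ [s _ <-]; apply: chain_weight_ge0.
have leN x : chain_norm (- x) <= chain_norm x.
  apply: lb_le_inf; first exact: (chain_weights_has_inf x).1.
  move=> _ [s [sV <-] <-]; apply: chain_norm_le.
  exists [seq (a.1, - a.2) | a <- s]; last by rewrite /chain_weight big_map.
  split; last by rewrite /chain_sum big_map sumrN.
  rewrite /chain all_map; apply: sub_all sV => a /=; rewrite !inE.
  exact: VN.
split=> //.
- apply/eqP; rewrite eq_le ge0 andbT; apply: chain_norm_le.
  exists [::]; last by rewrite /chain_weight big_nil.
  by split=> //; rewrite /chain_sum big_nil.
- move=> x x0; apply: Vsep => n; apply: chain_norm_lt_geo.
  by rewrite x0 exprn_gt0// invr_gt0.
- by move=> x; apply/eqP; rewrite eq_le leN -{1}[x]opprK leN.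
- move=> x y; rewrite -lerBlDr; apply: lb_le_inf.
    exact: (chain_weights_has_inf x).1.
  move=> _ [s [sV <-] <-]; rewrite lerBlDr -lerBlDl; apply: lb_le_inf.
    exact: (chain_weights_has_inf y).1.
  move=> _ [t [tV <-] <-]; rewrite lerBlDl; apply: chain_norm_le.
  exists (s ++ t); last by rewrite /chain_weight big_cat.
  by split; [rewrite /chain all_cat; apply/andP|rewrite /chain_sum big_cat].
Qed.

Lemma birkhoff_kakutani : exists tau : group_topology G,
  metrizable R (with_topology tau) /\
  forall A : set (with_topology tau), nbhs 0 A <-> exists n, V n `<=` A.
Proof.
have np := chain_norm_group_norm.
exists (norm_group_topology np); split; first exact: norm_topology_metrizable.
move=> A; have ballE e : norm_ball chain_norm 0 e = [set x | chain_norm x < e].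
  by apply/funext => x; rewrite /norm_ball /= sub0r (group_normN np).
split=> [/(nbhs_norm_topologyP np)[e e0]|[n VA]].
  rewrite ballE => eA.
  have [n ne] : exists n, 2^-1 ^+ n < e.
    have half1 : `|2^-1 : R| < 1 by rewrite ger0_norm ?invr_ge0// invf_lt1// ltr1n.
    have /cvgr0_norm_lt/(_ e e0)[n _ /(_ n (leqnn n))] := cvg_expr half1.
    by rewrite /= ger0_norm ?exprn_ge0 ?invr_ge0// => ne; exists n.
  by exists n => x /chain_norm_le_geo xn; apply: eA; apply: le_lt_trans ne.
apply/(nbhs_norm_topologyP np); exists (2^-1 ^+ n).
  by rewrite exprn_gt0// invr_gt0.
by rewrite ballE => x /chain_norm_lt_geo/VA.
Qed.

End BirkhoffKakutani.

(** * Shrinking neighborhoods of 0 in a Hausdorff group *)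

Lemma nbhs0_third (G : topologicalZmodType) (U : set G) : nbhs 0 U ->
  exists W : set G, [/\ nbhs 0 W, forall x, W x -> W (- x) &
    forall x y z, W x -> W y -> W z -> U (x + y + z)].
Proof.
have half (B : set G) : nbhs 0 B ->
    exists2 C : set G, nbhs 0 C & forall x y, C x -> C y -> B (x + y).
  move=> nB; have := @add_continuous G (0, 0) B; rewrite /= addr0 => /(_ nB).
  move=> [[C D] /= [nC nD] CD]; exists (C `&` D); first exact: filterI.
  by move=> x y [Cx _] [_ Dy]; apply: (CD (x, y)).
move=> /half[B /half[C nC CB] BU].
have nNC : nbhs 0 [set x | C (- x)].
  by apply: (@opp_continuous G 0 C); rewrite oppr0.
exists (C `&` [set x | C (- x)]); split; first exact: filterI.
- by move=> x [Cx CNx]; split=> //=; rewrite opprK.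
- move=> x y z [Cx _] [Cy _] [Cz _]; apply: BU; first exact: CB.
  (* The third summand is padded with 0, an element of [C], to land in [B]. *)
  by rewrite -[z]addr0; apply: CB => //; apply: nbhs_singleton.
Qed.

(** Each [W n.+1] is a symmetric third of [W n] cut down by a neighborhood of 0 that misses [h n]
    whenever [h n] is nonzero. Thus one point is excluded at each stage. *)
Lemma countable_separating_nbhs (G : topologicalZmodType) (h : nat -> G) :
  hausdorff_space G -> exists W : nat -> set G,
    [/\ forall n, nbhs 0 (W n), forall n x, W n x -> W n (- x),
        forall n x y z, W n.+1 x -> W n.+1 y -> W n.+1 z -> W n (x + y + z)
      & forall n, (forall m, W m (h n)) -> h n = 0].
Proof.
move=> hG.
(* Choice asks for a total function; the value at a [U] that is not a neighborhood of 0 is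
   arbitrary. *)
have /choice[g gP] (U : set G) : exists W : set G, nbhs 0 U ->
    [/\ nbhs 0 W, forall x, W x -> W (- x) &
    forall x y z, W x -> W y -> W z -> U (x + y + z)].
  by have [/nbhs0_third[W WP]|nU] := pselect (nbhs 0 U); [exists W|exists U].
pose avoid n : set G := [set x | h n = 0 \/ x <> h n].
have nbhs_avoid n : nbhs 0 (avoid n).
  have [h0|hn0] := pselect (h n = 0); first by apply: nearW => x; left.
  (* A neighborhood of 0 missing [h n] would be contained in [avoid n]. So otherwise [h n] lies in
     all of them and cannot be separated from 0. *)
  apply: contrapT => nav; apply: hn0; apply/esym/hG => A B nA nB.
  exists (h n); split; last exact: nbhs_singleton.
  apply: contrapT => nAh; apply: nav; apply: filterS nA => x Ax; right=> xh.
  by apply: nAh; rewrite -xh.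
pose fix W n := if n is m.+1 then g (W m `&` avoid m) else g setT.
have nW n : nbhs 0 (W n).
  elim: n => [|n IH] /=; first by have [] := gP setT filterT.
  by have [] := gP (W n `&` avoid n) (filterI IH (nbhs_avoid n)).
have WS n := gP _ (@filterI _ _ (nbhs_filter 0) _ _ (nW n) (nbhs_avoid n)).
exists W; split=> //.
- by case=> [|n] x; [have [_ + _] := gP setT filterT|have [_ + _] := WS n]; apply.
- by move=> n x y z Wx Wy Wz; have [_ _ /(_ _ _ _ Wx Wy Wz)[]] := WS n.
- move=> n hW; have [_ _] := WS n.
  (* Writing [h n] as [h n + 0 + 0] carries it from [W n.+1] into [avoid n]. *)
  have W0 : W n.+1 0 by apply: nbhs_singleton.
  by move=> /(_ _ _ _ (hW n.+1) W0 W0); rewrite !addr0 => -[_ []].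
Qed.

(** * The subgroup generated by the sequence, and the topology built from its traces *)

Section Combinations.
Context (G : zmodType) (u : nat -> G).

(** Lists of coefficient-index pairs form a countable type, so the subgroup of combinations can be
    enumerated through their codes. *)
Definition combination (s : seq (int * nat)) : G := \sum_(a <- s) u a.2 *~ a.1.

Lemma combination_gen n : range combination (u n).
Proof. by exists [:: (1, n)]; rewrite // /combination big_seq1. Qed.

Lemma combinationB : zmod_closed (fun x => x \in range combination).
Proof.
split=> [|x y].
  by rewrite inE; exists [::]; rewrite // /combination big_nil.
rewrite !inE => -[s _ <-] [t _ <-].
exists (s ++ [seq (- a.1, a.2) | a <- t]) => //.
rewrite /combination big_cat big_map /= -sumrN; congr (_ + _).
by apply: eq_bigr => a _; rewrite mulrNz.
Qed.

Lemma generated_subgroup_sub : generated_subgroup (range u) `<=` range combination.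
Proof.
apply: smallest_sub; first exact: combinationB.
by move=> _ [n _ <-]; apply: combination_gen.
Qed.

End Combinations.

(** The comparison is made on the subgroup [H] only, since [H] becomes open in [tau']. This suffices
    for the convergence of [u], and when [H] is all of [G] it makes [tau'] coarser than [tau]. *)
Lemma coarser_metrizable_topology (R : realType) (G : zmodType)
    (u : nat -> G) (tau : group_topology G) :
  hausdorff_space (with_topology tau) -> exists tau' : group_topology G,
    metrizable R (with_topology tau') /\
    forall A : set G, nbhs (0 : with_topology tau') A ->
      exists2 B : set G, nbhs (0 : with_topology tau) B &
        B `&` range (combination u) `<=` A.
Proof.
move=> hG; set H := range (combination u).
(* Numbers that code no list are sent to the empty combination, 0. *)
pose h n : with_topology tau := combination u (odflt [::] (unpickle n)).
have [W [nW WN WD3 Wsep]] := countable_separating_nbhs h hG.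
have [H0 HB] := combinationB u.
have HN x : H x -> H (- x).
  by move=> Hx; rewrite -sub0r; have := HB 0 x; rewrite !inE; apply=> //; rewrite -inE.
have HD x y : H x -> H y -> H (x + y).
  by move=> Hx /HN Hy; have := HB x (- y); rewrite opprK !inE; apply.
(* The shift by one frees index 0 for the whole group, as the chain construction demands. *)
pose V n : set G := if n is m.+1 then W m `&` H else setT.
have [|||||tau' [mtau' nbhsV]] := @birkhoff_kakutani R G V; last first.
- exists tau'; split=> // A /nbhsV[[|n] VA].
    by exists setT; [exact: filterT|rewrite setTI => x _; exact: VA].
  by exists (W n).
(* Membership in [V 1] already places [x] in [H], so [x] is some [h n] and the separation of the
   [W m] applies. *)
- move=> x Vx; have [s _ sx] := (Vx 1%N).2.
  have hx : h (pickle s) = x by rewrite /h pickleK.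
  by rewrite -hx; apply: Wsep => m; rewrite hx; exact: (Vx m.+1).1.
- case=> [//|n] x y z [Wx Hx] [Wy Hy] [Wz Hz]; split; first exact: WD3.
  by apply: (HD (x + y)) => //; apply: HD.
- by case=> [//|n] x [Wx Hx]; split; [exact: WN|exact: HN].
- case=> [//|n]; split; first exact: (nbhs_singleton (nW n)).
  by rewrite inE in H0.
- by [].
Qed.

Theorem proposition3p10 (R : realType) (I : set_system nat) (G : zmodType)
    (u : nat -> G) (hI : is_ideal I) :
  (T_sequence I u ->
     exists tau : group_topology G,
       metrizable R (with_topology tau) /\
       ideal_cvg I (u : nat -> with_topology tau) 0)
  /\
  (TB_sequence I u ->
     generated_subgroup (range u) = [set: G] ->
     exists tau : group_topology G,
       [/\ precompact_group (with_topology tau),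
           metrizable R (with_topology tau) &
           ideal_cvg I (u : nat -> with_topology tau) 0]).
Proof.
have [_ Isub _] := hI.
have cvg_coarser (tau tau' : group_topology G) :
    (forall A : set G, nbhs (0 : with_topology tau') A ->
      exists2 B : set G, nbhs (0 : with_topology tau) B &
        B `&` range (combination u) `<=` A) ->
    ideal_cvg I (u : nat -> with_topology tau) 0 ->
    ideal_cvg I (u : nat -> with_topology tau') 0.
  (* All [u n] lie in the subgroup, so an index exceptional for [A] is exceptional for [B]. *)
  move=> coarser ucvg A /coarser[B nB BA]; apply: Isub (ucvg _ nB) => n nAu Bu.
  by apply: nAu; apply: BA; split=> //; apply: combination_gen.
split=> [[tau [htau ucvg]]|[tau [[htau tbtau] ucvg]] uG];
    have [tau' [mtau' coarser]] := coarser_metrizable_topology R u htau.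
  by exists tau'; split=> //; apply: cvg_coarser ucvg.
exists tau'; split=> //; last exact: cvg_coarser ucvg.
split; first exact: metrizable_hausdorff mtau'.
(* As [u] generates [G], all of [B] lies in [A], and the finite set [F] chosen for [B] also serves
   [A]. *)
move=> A /coarser[B nB BA]; have [F finF FB] := tbtau _ nB.
exists F => //; apply/seteqP; split=> // x _.
have : [set x + y | x in F & y in B] x by rewrite FB.
move=> [a Fa [b Bb abx]]; exists a => //; exists b => //.
by apply: BA; split=> //; apply: generated_subgroup_sub; rewrite uG.
Qed.
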